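(* Let $\epsilon_0>0$ be fixed, and let $K=K_n\ge2$, $a=a_n$, $b=b_n$ satisfy $\epsilon_0<b<a$, $a/n<1-\epsilon_0$. Let $\eta_n\to0$ be a sequence with $\eta_n\ge 2K/n$. If $\frac{nI}{K}\to\infty$, then $$\inf_{\hat\sigma}\sup_{\sigma\in\Theta^0(n,K,a,b)}\mathbb{E}\, r(\sigma,\hat\sigma)\ge \exp\Big(-(1+o(1))\frac{nI}{K}\Big).$$ If $\frac{nI}{K}=O(1)$, then $\inf_{\hat\sigma}\sup_{\sigma\in\Theta^0(n,K,a,b)}\mathbb{E}\, r(\sigma,\hat\sigma)\ge c$ for some constant $c>0$ not depending on $n$.
   Context: SBM: for an assignment $\sigma:[n]\to[K]$ (community sizes $n_k=|\{i:\sigma(i)=k\}|$) and probabilities $\{\theta_{i,j}\}$, one observes a symmetric $A\in\{0,1\}^{n\times n}$ with $A_{i,i}=0$ and independent $A_{i,j}\sim\mathrm{Ber}(\theta_{i,j})$, $i<j$. The approximately equal-size homogeneous space $\Theta^0(n,K,a,b)$ (with tolerance sequence $\eta_n\to 0$) is the set of assignments $\sigma:[n]\to[K]$ with $n_k\in[(1-\eta_n)\frac nK,(1+\eta_n)\frac nK]$ for all $k$, together with $\theta_{i,j}=a/n$ if $\sigma(i)=\sigma(j)$, $\theta_{i,j}=b/n$ if $\sigma(i)\ne\sigma(j)$ ($i\neq j$), $\theta_{i,i}=0$. $I=-2\log\big(\sqrt{\frac{a}{n}\frac{b}{n}}+\sqrt{(1-\frac{a}{n})(1-\frac{b}{n})}\big)$.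 Mis-match ratio $r(\sigma,\hat\sigma)=\min_\delta d_H(\sigma,\delta\circ\hat\sigma)/n$ over permutations $\delta$ of $[K]$, $d_H$ the Hamming distance. Infimum over all (possibly randomized) estimators. ''$\exp(-(1+o(1))G)$'' means $\exp(-(1+\delta_n)G)$ for some sequence $\delta_n\to0$. *)

(* Defs.v *)
From HB Require Import structures.
From mathcomp Require Import all_boot all_fingroup.
From Stdlib Require Import Reals.

Set Implicit Arguments. Unset Strict Implicit. Unset Printing Implicit Defensive.

Definition assignment (n K : nat) := {ffun 'I_n -> 'I_K}.

Definition adjmat (n : nat) := {ffun 'I_n * 'I_n -> bool}.

Definition is_adj (n : nat) (A : adjmat n) : bool :=
  [forall i : 'I_n, [forall j : 'I_n,
     (A (i, j) == A (j, i)) && ((i == j) ==> ~~ A (i, j))]].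

Definition theta (n K : nat) (a b : R) (s : assignment n K) (i j : 'I_n) : R :=
  if s i == s j then (a / INR n)%R else (b / INR n)%R.

Definition probA (n K : nat) (a b : R) (s : assignment n K) (A : adjmat n) : R :=
  \big[Rmult/1%R]_(p : 'I_n * 'I_n | (nat_of_ord p.1 < nat_of_ord p.2)%N)
     (if A p then theta a b s p.1 p.2 else (1 - theta a b s p.1 p.2)%R).

Definition hamming_perm (n K : nat) (s t : assignment n K) (d : {perm 'I_K}) : nat :=
  #|[set i : 'I_n | s i != d (t i)]|.

(* mis-match ratio r(s,t) = min_d d_H(s, d o t) / n  (d_H <= n, so n is a neutral start) *)
Definition mismatch (n K : nat) (s t : assignment n K) : R :=
  (INR (\big[minn/n]_(d : {perm 'I_K}) hamming_perm s t d) / INR n)%R.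

Definition Rleb (x y : R) : bool := if Rle_dec x y then true else false.

Definition comm_size (n K : nat) (s : assignment n K) (k : 'I_K) : nat :=
  #|[set i : 'I_n | s i == k]|.

Definition in_Theta0 (n K : nat) (eta : R) (s : assignment n K) : bool :=
  [forall k : 'I_K,
     Rleb ((1 - eta) * (INR n / INR K))%R (INR (comm_size s k)) &&
     Rleb (INR (comm_size s k)) ((1 + eta) * (INR n / INR K))%R].

(* a (possibly randomized) estimator: for each observed A a probability
   distribution q A over assignments *)
Definition estimator (n K : nat) := adjmat n -> assignment n K -> R.

Definition is_estimator (n K : nat) (q : estimator n K) : Prop :=
  (forall A t, (0 <= q A t)%R) /\
  (forall A, \big[Rplus/0%R]_(t : assignment n K) q A t = 1%R).

Definition risk (n K : nat) (a b : R) (q : estimator n K) (s : assignment n K) : R :=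
  \big[Rplus/0%R]_(A : adjmat n | is_adj A)
    (probA a b s A *
     \big[Rplus/0%R]_(t : assignment n K) (q A t * mismatch s t))%R.

(* sup over Theta^0 (finite set; risks are >= 0 so 0 is a neutral start) *)
Definition worst_risk (n K : nat) (a b eta : R) (q : estimator n K) : R :=
  \big[Rmax/0%R]_(s : assignment n K | in_Theta0 eta s) risk a b q s.

Definition SBM_I (n : nat) (a b : R) : R :=
  (- 2 * ln (sqrt (a / INR n * (b / INR n))
             + sqrt ((1 - a / INR n) * (1 - b / INR n))))%R.

(* Main.v *)
(* A worst-case risk dominates an average over a prior. Take a nearly equal-size
   base assignment, reveal the labels of half the nodes of each community, match
   the communities in pairs, and let the prior be uniform over the assignments
   whose community sizes are those of the base, up to one node moved within
   each pair. The revealed nodes fix, up to a constant factor, the permutation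
   in the mis-match ratio. For a positive fraction of the nodes, moving the node
   to the partner community stays in the support of the prior, so its error is at
   least that of a test between two assignments which differ at this node only.
   Under the normalised geometric mean of the two laws the log-likelihood ratio
   has second moment O(nI/K) (its logarithmic terms are controlled by the
   Hellinger distance), so that test has error at least
   c exp (- nI/K - C sqrt (nI/K)). *)

Require Import Defs.
From HB Require Import structures.
From mathcomp Require Import all_boot all_fingroup.
From Stdlib Require Import Reals Lra.
From mathcomp Require Import zify.

Set Implicit Arguments. Unset Strict Implicit. Unset Printing Implicit Defensive.

(** * Testing two product measures *)

Fact Rplus_associative : associative Rplus.
Proof. by move=> x y z; ring. Qed.
Fact Rmult_associative : associative Rmult.
Proof. by move=> x y z; ring. Qed.
HB.instance Definition _ :=
  Monoid.isComLaw.Build R 0%R Rplus Rplus_associative Rplus_comm Rplus_0_l.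
HB.instance Definition _ :=
  Monoid.isComLaw.Build R 1%R Rmult Rmult_associative Rmult_comm Rmult_1_l.
HB.instance Definition _ :=
  Monoid.isMulLaw.Build R 0%R Rmult Rmult_0_l Rmult_0_r.
HB.instance Definition _ :=
  Monoid.isAddLaw.Build R Rmult Rplus
    (fun x y z => Rmult_plus_distr_r x y z) (fun x y z => Rmult_plus_distr_l x y z).

Lemma Rsum_le (I : finType) (P : pred I) (F G : I -> R) :
  (forall i, P i -> (F i <= G i)%R) ->
  (\big[Rplus/0%R]_(i | P i) F i <= \big[Rplus/0%R]_(i | P i) G i)%R.
Proof.
move=> FG; elim/big_rec2: _ => [|i x y Pi]; first exact: Rle_refl.
by move: (FG i Pi); lra.
Qed.

Lemma Rsum_ge0 (I : finType) (P : pred I) (F : I -> R) :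
  (forall i, P i -> (0 <= F i)%R) -> (0 <= \big[Rplus/0%R]_(i | P i) F i)%R.
Proof.
move=> F0; elim/big_rec: _ => [|i x Pi]; first exact: Rle_refl.
by move: (F0 i Pi); lra.
Qed.

Lemma Rprod_ge0 (I : finType) (P : pred I) (F : I -> R) :
  (forall i, P i -> (0 <= F i)%R) -> (0 <= \big[Rmult/1%R]_(i | P i) F i)%R.
Proof.
move=> F0; elim/big_rec: _ => [|i x Pi x0]; first lra.
exact: Rmult_le_pos (F0 i Pi) x0.
Qed.

Lemma Rsum_const (I : finType) (P : pred I) (c : R) :
  \big[Rplus/0%R]_(i | P i) c = (INR #|P| * c)%R.
Proof.
rewrite big_const; elim: #|P| => [|k IH]; first by rewrite /=; ring.
by rewrite iterS IH S_INR; ring.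
Qed.

Lemma Rsum_indic (I : finType) (P Q : pred I) (c : R) :
  \big[Rplus/0%R]_(i | P i) (if Q i then c else 0%R)
  = (INR #|[pred i | P i && Q i]| * c)%R.
Proof. by rewrite -big_mkcondr Rsum_const. Qed.

Lemma Rsum_sqr (I : finType) (F : I -> R) :
  ((\big[Rplus/0%R]_x F x) ^ 2
   = \big[Rplus/0%R]_x \big[Rplus/0%R]_y (F x * F y))%R.
Proof.
by rewrite /= Rmult_1_r big_distrl; apply: eq_bigr => x _; rewrite big_distrr.
Qed.

Lemma Rprod_exp (I : finType) (F : I -> R) :
  \big[Rmult/1%R]_i exp (F i) = exp (\big[Rplus/0%R]_i F i).
Proof. by elim/big_rec2: _ => [|i x y _ ->]; rewrite ?exp_0 ?exp_plus. Qed.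

Lemma expect_prod (I : finType) (w y : I -> bool -> R) :
  \big[Rplus/0%R]_(A : {ffun I -> bool})
     ((\big[Rmult/1%R]_x w x (A x)) * \big[Rmult/1%R]_x y x (A x))%R
  = \big[Rmult/1%R]_x (w x true * y x true + w x false * y x false)%R.
Proof.
transitivity (\big[Rmult/1%R]_x \big[Rplus/0%R]_(c : bool) (w x c * y x c)%R).
  rewrite bigA_distr_bigA; apply: eq_bigr => A _.
  by rewrite -big_split.
by apply: eq_bigr => x _; rewrite big_bool.
Qed.

Lemma expect_one (I : finType) (w : I -> bool -> R) :
  (forall x, w x true + w x false = 1)%R ->
  \big[Rplus/0%R]_(A : {ffun I -> bool}) \big[Rmult/1%R]_x w x (A x) = 1%R.
Proof.
move=> w1; transitivity (\big[Rmult/1%R]_(x : I) 1%R); last by rewrite big1.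
rewrite -(eq_bigr _ (fun x _ => w1 x)).
transitivity (\big[Rmult/1%R]_x \big[Rplus/0%R]_(c : bool) w x c).
  by rewrite bigA_distr_bigA.
by apply: eq_bigr => x _; rewrite big_bool.
Qed.

Lemma expect_pair (I : finType) (w l : I -> bool -> R) (p r : I) :
  (forall x, w x true + w x false = 1)%R ->
  \big[Rplus/0%R]_(A : {ffun I -> bool})
     ((\big[Rmult/1%R]_x w x (A x)) * (l p (A p) * l r (A r)))%R
  = (if p == r then w p true * l p true ^ 2 + w p false * l p false ^ 2
     else (w p true * l p true + w p false * l p false)
          * (w r true * l r true + w r false * l r false))%R.
Proof.
move=> w1.
pose y x c := ((if x == p then l p c else 1) * (if x == r then l r c else 1))%R.
have yE (A : {ffun I -> bool}) :
    (l p (A p) * l r (A r))%R = \big[Rmult/1%R]_x y x (A x).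
  by rewrite big_split /= -!big_mkcond !big_pred1_eq.
under eq_bigr => A _ do rewrite yE.
rewrite expect_prod (bigD1 p) //= {1 2}/y eqxx.
case: eqP => [pr|/eqP pr].
  subst r.
  rewrite big1 => [|x /negbTE xp]; first by ring.
  by rewrite /y xp -[RHS](w1 x) /=; ring.
have rp : (r == p) = false by rewrite eq_sym; apply/negbTE.
rewrite (bigD1 r) ?rp //= {1 2}/y eqxx rp.
rewrite big1 => [|x /andP[/negbTE xp /negbTE xr]]; first by ring.
by rewrite /y xp xr -[RHS](w1 x) /=; ring.
Qed.

(** Under a product law the cross terms factor into products of means, so only the diagonal needs
    second moments. It is an inequality because the squared sum of the means also carries the
    diagonal terms [mu p ^ 2], which are nonnegative. *)
Lemma expect_sqr_sum (I : finType) (w l : I -> bool -> R) :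
  (forall x, w x true + w x false = 1)%R ->
  (\big[Rplus/0%R]_(A : {ffun I -> bool})
     ((\big[Rmult/1%R]_x w x (A x)) * (\big[Rplus/0%R]_x l x (A x)) ^ 2)
   <= \big[Rplus/0%R]_x (w x true * l x true ^ 2 + w x false * l x false ^ 2)
      + (\big[Rplus/0%R]_x (w x true * l x true + w x false * l x false)) ^ 2)%R.
Proof.
move=> w1.
set mu := fun x => (w x true * l x true + w x false * l x false)%R.
set v := fun x => (w x true * l x true ^ 2 + w x false * l x false ^ 2)%R.
have -> : \big[Rplus/0%R]_(A : {ffun I -> bool})
     ((\big[Rmult/1%R]_x w x (A x)) * (\big[Rplus/0%R]_x l x (A x)) ^ 2)%R
   = \big[Rplus/0%R]_p \big[Rplus/0%R]_r (if p == r then v p else mu p * mu r)%R.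
  transitivity (\big[Rplus/0%R]_(A : {ffun I -> bool}) \big[Rplus/0%R]_p
      \big[Rplus/0%R]_r ((\big[Rmult/1%R]_x w x (A x)) * (l p (A p) * l r (A r)))%R).
    apply: eq_bigr => A _; rewrite Rsum_sqr big_distrr; apply: eq_bigr => p _.
    by rewrite big_distrr.
  rewrite exchange_big; apply: eq_bigr => p _.
  by rewrite exchange_big; apply: eq_bigr => r _; exact: expect_pair.
rewrite Rsum_sqr -big_split; apply: Rsum_le => p _ /=.
rewrite (bigD1 p) //= eqxx [X in (_ <= _ + X)%R](bigD1 p) //=.
rewrite (eq_bigr (fun r => mu p * mu r)%R); last first.
  by move=> r rp; rewrite eq_sym (negbTE rp).
set X := \big[Rplus/0%R]_(i | i != p) (mu p * mu i)%R.
change (v p + X <= v p + (mu p * mu p + X))%R.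
by move: (Rle_0_sqr (mu p)); rewrite /Rsqr; lra.
Qed.

(** The bound [1 + u <= exp u] at [u = s / 2 - |L| / 2], followed by [2 |L| <= L ^ 2 / s + s]. The
    result is affine in [L ^ 2], so it can be integrated knowing only a second moment; when that
    moment is at most [s ^ 2], the bracket has mean at least 1. *)
Lemma exp_abs_half_ge (s L : R) : (0 < s)%R ->
  (exp (- s / 2) * (1 + s / 2 - (L ^ 2 / s + s) / 4) <= exp (- Rabs L / 2))%R.
Proof.
move=> s0.
have -> : (- Rabs L / 2 = - s / 2 + (s / 2 - Rabs L / 2))%R by field.
rewrite exp_plus; apply: Rmult_le_compat_l; first exact/Rlt_le/exp_pos.
have := exp_ineq1_le (s / 2 - Rabs L / 2).
suff : (2 * Rabs L <= L ^ 2 / s + s)%R by lra.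
have -> : (L ^ 2 / s + s = 2 * Rabs L + (Rabs L - s) ^ 2 / s)%R.
  have -> : (L ^ 2 = Rabs L ^ 2)%R by rewrite pow2_abs.
  by field; lra.
suff : (0 <= (Rabs L - s) ^ 2 / s)%R by lra.
by apply: Rmult_le_pos; [exact: pow2_ge_0 | exact/Rlt_le/Rinv_0_lt_compat].
Qed.

(* With [W] the normalised geometric mean of the two product measures and [L]
   their log-likelihood ratio, the minimum of the measures is
   [(\prod rho) W exp (- |L| / 2)]. *)
Lemma testing_affinity (I : finType) (rho : I -> R) (w l : I -> bool -> R) (s : R) :
  (0 < s)%R -> (forall x, 0 <= rho x)%R ->
  (forall x c, 0 <= w x c)%R -> (forall x, w x true + w x false = 1)%R ->
  (\big[Rplus/0%R]_x (w x true * l x true ^ 2 + w x false * l x false ^ 2)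
   + (\big[Rplus/0%R]_x (w x true * l x true + w x false * l x false)) ^ 2 <= s ^ 2)%R ->
  ((\big[Rmult/1%R]_x rho x) * exp (- s / 2)
   <= \big[Rplus/0%R]_(A : {ffun I -> bool})
        Rmin (\big[Rmult/1%R]_x (rho x * w x (A x) * exp (l x (A x) / 2)))
             (\big[Rmult/1%R]_x (rho x * w x (A x) * exp (- l x (A x) / 2))))%R.
Proof.
move=> s0 rho0 w0 w1 Ls.
set Z := \big[Rmult/1%R]_x rho x.
have Z0 : (0 <= Z)%R by apply: Rprod_ge0.
pose W (A : {ffun I -> bool}) := \big[Rmult/1%R]_x w x (A x).
pose L (A : {ffun I -> bool}) := \big[Rplus/0%R]_x l x (A x).
have W0 A : (0 <= W A)%R by apply: Rprod_ge0.
have W1 : \big[Rplus/0%R]_A W A = 1%R by exact: expect_one.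
have WL : (\big[Rplus/0%R]_A (W A * L A ^ 2) <= s ^ 2)%R.
  exact: Rle_trans (expect_sqr_sum l w1) Ls.
apply: (Rle_trans _ (\big[Rplus/0%R]_A
   (Z * (W A * (exp (- s / 2) * (1 + s / 2 - (L A ^ 2 / s + s) / 4)))))%R).
  (* By [W1] the bracket has [W]-mean [1 + s / 4 - E / (4 s)], with [E] the second moment of [L]; by
     [WL] this is at least 1. *)
  rewrite -big_distrr /=; apply: Rmult_le_compat_l => //.
  rewrite (eq_bigr (fun A => exp (- s / 2) * (1 + s / 4) * W A
     + (- exp (- s / 2) / (4 * s)) * (W A * L A ^ 2))%R); last first.
    by move=> A _; field; lra.
  rewrite big_split -!big_distrr /= W1.
  have := exp_pos (- s / 2).
  set e := exp _ => e0.
  have : (e / (4 * s) * \big[Rplus/0]_A (W A * L A ^ 2) <= e / (4 * s) * s ^ 2)%R.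
    apply: Rmult_le_compat_l => //.
    by apply: Rmult_le_pos; [lra | apply/Rlt_le/Rinv_0_lt_compat; lra].
  rewrite /= !Rmult_1_r.
  have -> : (e / (4 * s) * (s * s) = e * s / 4)%R by field; lra.
  have -> : (- e / (4 * s) = - (e / (4 * s)))%R by field; lra.
  lra.
apply: Rsum_le => A _.
have split_exp (f : I -> R) :
   \big[Rmult/1%R]_x (rho x * w x (A x) * exp (f x))%R
   = (Z * (W A * exp (\big[Rplus/0%R]_x f x)))%R.
  by rewrite !big_split /= Rprod_exp; rewrite /Z /W; ring.
rewrite !split_exp.
have -> : \big[Rplus/0%R]_x (l x (A x) / 2)%R = (L A / 2)%R.
  by rewrite -big_distrl.
have -> : \big[Rplus/0%R]_x (- l x (A x) / 2)%R = (- L A / 2)%R.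
  rewrite (eq_bigr (fun x => l x (A x) * (- / 2))%R); last by move=> *; field.
  by rewrite -big_distrl /= -/(L A); field.
have exp_le u v : (u <= v -> exp u <= exp v)%R.
  by case=> [/exp_increasing|->]; lra.
have bnd := exp_abs_half_ge (L A) s0.
have h1 : (exp (- Rabs (L A) / 2) <= exp (L A / 2))%R.
  by apply: exp_le; split_Rabs; lra.
have h2 : (exp (- Rabs (L A) / 2) <= exp (- L A / 2))%R.
  by apply: exp_le; split_Rabs; lra.
by apply: Rmin_glb; apply: Rmult_le_compat_l => //; apply: Rmult_le_compat_l => //; lra.
Qed.

(** * Geometric mean and log-likelihood ratio of two Bernoulli laws *)

Definition bern (p : R) (c : bool) : R := if c then p else (1 - p)%R.

(** The Bhattacharyya coefficient of two Bernoulli laws; [SBM_I] is minus twice its logarithm at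
    [a / n] and [b / n]. *)
Definition affinity (p q : R) : R := (sqrt (p * q) + sqrt ((1 - p) * (1 - q)))%R.

Definition tilt (p q : R) (c : bool) : R :=
  (sqrt (bern p c * bern q c) / affinity p q)%R.

Definition llr (p q : R) (c : bool) : R := ln (bern p c / bern q c).

Definition llr_mean (p q : R) : R :=
  (tilt p q true * llr p q true + tilt p q false * llr p q false)%R.

Definition llr_sqmean (p q : R) : R :=
  (tilt p q true * llr p q true ^ 2 + tilt p q false * llr p q false ^ 2)%R.

Lemma bern_gt0 (p : R) (c : bool) : (0 < p < 1)%R -> (0 < bern p c)%R.
Proof. by case: c => /=; lra. Qed.

Lemma affinity_gt0 (p q : R) : (0 < p < 1)%R -> (0 < q < 1)%R -> (0 < affinity p q)%R.
Proof.
move=> p01 q01; apply: Rplus_lt_0_compat; apply: sqrt_lt_R0; apply: Rmult_lt_0_compat; lra.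
Qed.

Lemma tilt_ge0 (p q : R) (c : bool) :
  (0 < p < 1)%R -> (0 < q < 1)%R -> (0 <= tilt p q c)%R.
Proof.
move=> p01 q01; apply: Rmult_le_pos; first exact: sqrt_pos.
exact/Rlt_le/Rinv_0_lt_compat/affinity_gt0.
Qed.

Lemma tilt_sum (p q : R) :
  (0 < p < 1)%R -> (0 < q < 1)%R -> (tilt p q true + tilt p q false = 1)%R.
Proof.
move=> p01 q01; have := affinity_gt0 p01 q01; rewrite /tilt /= => r0.
by rewrite -Rdiv_plus_distr; apply: Rinv_r; apply: Rgt_not_eq.
Qed.

Lemma affinityC (p q : R) : affinity p q = affinity q p.
Proof. by rewrite /affinity Rmult_comm [((1 - p) * _)%R]Rmult_comm. Qed.

Lemma tiltC (p q : R) (c : bool) : tilt p q c = tilt q p c.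
Proof. by rewrite /tilt affinityC Rmult_comm. Qed.

Lemma llrN (p q : R) (c : bool) :
  (0 < p < 1)%R -> (0 < q < 1)%R -> (llr q p c = - llr p q c)%R.
Proof.
move=> p01 q01; have bp := bern_gt0 c p01; have bq := bern_gt0 c q01.
rewrite -ln_Rinv; last by apply: Rmult_lt_0_compat => //; apply: Rinv_0_lt_compat.
by rewrite /llr Rinv_div.
Qed.

Lemma ln_div (x y : R) : (0 < x)%R -> (0 < y)%R -> (ln (x / y) = ln x - ln y)%R.
Proof.
by move=> x0 y0; rewrite ln_mult ?ln_Rinv //; exact: Rinv_0_lt_compat.
Qed.

Lemma geomean_exp_ln (x y : R) : (0 < x)%R -> (0 < y)%R ->
  (sqrt (x * y) * exp (ln (x / y) / 2) = x)%R.
Proof.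
move=> x0 y0; rewrite -Rpower_sqrt; last exact: Rmult_lt_0_compat.
rewrite /Rpower ln_mult // ln_div // -exp_plus.
by rewrite -[RHS]exp_ln //; congr exp; field.
Qed.

Lemma bern_tilt (p q : R) (c : bool) : (0 < p < 1)%R -> (0 < q < 1)%R ->
  (affinity p q * tilt p q c * exp (llr p q c / 2) = bern p c)%R.
Proof.
move=> p01 q01; have := affinity_gt0 p01 q01 => r0.
rewrite -[RHS](geomean_exp_ln (bern_gt0 c p01) (bern_gt0 c q01)).
by rewrite /tilt /llr; field; lra.
Qed.

Lemma affinity_diag (p : R) : (0 < p < 1)%R -> affinity p p = 1%R.
Proof. by move=> p01; rewrite /affinity !sqrt_square; lra. Qed.

Lemma llr_diag (p : R) (c : bool) : (0 < p < 1)%R -> llr p p c = 0%R.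
Proof.
move=> p01; have := bern_gt0 c p01 => ?.
by rewrite /llr Rdiv_diag ?ln_1 //; lra.
Qed.

(* The geometric mean is at most the logarithmic mean, up to a constant; it is
   applied to [sqrt x] and [sqrt y], hence the fourth roots [u] and [v]. *)
Lemma sqrt_mul_ln_sqr_le (x y : R) : (0 < x)%R -> (0 < y)%R ->
  (sqrt (x * y) * ln (x / y) ^ 2 <= 16 * (x + y - 2 * sqrt (x * y)))%R.
Proof.
wlog yx : x y / (y <= x)%R.
  move=> H x0 y0; case: (Rle_dec y x) => xy; first exact: H.
  have := H y x; rewrite [(y * x)%R]Rmult_comm.
  have -> : (ln (y / x) = - ln (x / y))%R by rewrite !ln_div //; ring.
  by rewrite /=; lra.
move=> x0 y0.
pose u := sqrt (sqrt x); pose v := sqrt (sqrt y).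
have u0 : (0 < u)%R by do 2 apply: sqrt_lt_R0.
have v0 : (0 < v)%R by do 2 apply: sqrt_lt_R0.
have vu : (v <= u)%R by do 2 (apply: sqrt_le_1; try exact: sqrt_pos; try lra).
have uu : sqrt x = (u * u)%R by rewrite sqrt_sqrt //; exact: sqrt_pos.
have vv : sqrt y = (v * v)%R by rewrite sqrt_sqrt //; exact: sqrt_pos.
have xE : x = (u * u * (u * u))%R by rewrite -uu sqrt_sqrt //; lra.
have yE : y = (v * v * (v * v))%R by rewrite -vv sqrt_sqrt //; lra.
rewrite sqrt_mult; try lra; rewrite uu vv.
(* The factor 4 of the fourth roots, once squared, is the constant 16. *)
have -> : (ln (x / y) = 4 * ln (u / v))%R.
  have uu0 := Rmult_lt_0_compat _ _ u0 u0.
  have vv0 := Rmult_lt_0_compat _ _ v0 v0.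
  by rewrite xE yE !ln_div ?ln_mult //; try ring; exact: Rmult_lt_0_compat.
have -> : (x + y - 2 * (u * u * (v * v)) = ((u - v) * (u + v)) ^ 2)%R.
  by rewrite xE yE; ring.
have t1 : (1 <= u / v)%R.
  by apply: (Rmult_le_reg_r v) => //; rewrite /Rdiv Rmult_assoc Rinv_l; lra.
have l0 : (0 <= ln (u / v))%R by rewrite -ln_1; case: t1 => [/(ln_increasing _ _ Rlt_0_1)|<-]; lra.
have l1 : (v * ln (u / v) <= u - v)%R.
  have := exp_ineq1_le (ln (u / v)); rewrite exp_ln; last lra.
  move=> H; have := Rmult_le_compat_l v _ _ (Rlt_le _ _ v0) H.
  have -> : (v * (u / v) = u)%R by field; lra.
  by lra.
set l := ln (u / v) in l0 l1 *.
have l2 : (0 <= v * l)%R by apply: Rmult_le_pos; lra.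
(* From [v * l <= u - v]; squaring this gives the claim, as [(u - v) * (u + v)] is
   [sqrt x - sqrt y]. *)
have h : (u * (v * l) <= (u - v) * (u + v))%R.
  have -> : ((u - v) * (u + v) = u * (u - v) + v * (u - v))%R by ring.
  have := Rmult_le_compat_l u _ _ (Rlt_le _ _ u0) l1.
  have : (0 <= v * (u - v))%R by apply: Rmult_le_pos; lra.
  by lra.
have := pow_incr (u * (v * l)) ((u - v) * (u + v)) 2 (conj (Rmult_le_pos _ _ (Rlt_le _ _ u0) l2) h).
have -> : (u * u * (v * v) * (4 * l) ^ 2 = 16 * (u * (v * l)) ^ 2)%R by ring.
by lra.
Qed.

(** Both sides are the sum over the two outcomes of the squared difference of the square roots of
    the probabilities, an unnormalised squared Hellinger distance. *)
Lemma bern_hellinger (p q : R) :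
  ((bern p true + bern q true - 2 * sqrt (bern p true * bern q true))
   + (bern p false + bern q false - 2 * sqrt (bern p false * bern q false))
   = 2 * (1 - affinity p q))%R.
Proof. by rewrite /affinity /=; ring. Qed.

Lemma affinity_le1 (p q : R) : (0 < p < 1)%R -> (0 < q < 1)%R -> (affinity p q <= 1)%R.
Proof.
move=> p01 q01; have := bern_hellinger p q.
have amgm c : (0 <= bern p c + bern q c - 2 * sqrt (bern p c * bern q c))%R.
  have bp := bern_gt0 c p01; have bq := bern_gt0 c q01.
  rewrite sqrt_mult; try lra.
  have := pow2_ge_0 (sqrt (bern p c) - sqrt (bern q c)).
  have := sqrt_sqrt (bern p c); have := sqrt_sqrt (bern q c).
  by rewrite /=; lra.
by move: (amgm true) (amgm false); lra.
Qed.

(** The non-edge term alone suffices: it is the geometric mean of two numbers above [e]. This keeps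
    the normalisation in [tilt] bounded. *)
Lemma affinity_ge (p q e : R) : (0 < e)%R -> (0 < p < 1 - e)%R -> (0 < q < 1 - e)%R ->
  (e <= affinity p q)%R.
Proof.
move=> e0 p01 q01; have := sqrt_pos (p * q).
suff : (e <= sqrt ((1 - p) * (1 - q)))%R by rewrite /affinity; lra.
rewrite -{1}(sqrt_square e); last lra.
by apply: sqrt_le_1; try apply: Rmult_le_pos; try apply: Rmult_le_compat; lra.
Qed.

(** Outcome by outcome, [sqrt_mul_ln_sqr_le] bounds the unnormalised moment by 16 times a Hellinger
    term. These terms add up to [2 * (1 - affinity p q)], which is at most
    [- 2 * ln (affinity p q)]; the normalisation costs [1 / e]. *)
Lemma llr_sqmean_le (p q e : R) :
  (0 < e)%R -> (0 < p < 1 - e)%R -> (0 < q < 1 - e)%R ->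
  (llr_sqmean p q <= 16 / e * (- 2 * ln (affinity p q)))%R.
Proof.
move=> e0 pe qe; have p01 : (0 < p < 1)%R by lra.
have q01 : (0 < q < 1)%R by lra.
have r0 := affinity_gt0 p01 q01; have re := affinity_ge e0 pe qe.
have r1 := affinity_le1 p01 q01.
have := bern_hellinger p q.
have := sqrt_mul_ln_sqr_le (bern_gt0 true p01) (bern_gt0 true q01).
have := sqrt_mul_ln_sqr_le (bern_gt0 false p01) (bern_gt0 false q01).
rewrite -/(llr p q true) -/(llr p q false) => hf ht hh.
have lnr : (ln (affinity p q) <= affinity p q - 1)%R.
  by have := exp_ineq1_le (ln (affinity p q)); rewrite exp_ln //; lra.
set r := affinity p q in r0 re r1 hh lnr *.
have -> : (llr_sqmean p q = (sqrt (bern p true * bern q true) * llr p q true ^ 2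
   + sqrt (bern p false * bern q false) * llr p q false ^ 2) / r)%R.
  by rewrite /llr_sqmean /tilt -/r; field; lra.
apply: (Rle_trans _ (16 * (- 2 * ln r) / r)%R).
  apply: Rmult_le_compat_r; first exact/Rlt_le/Rinv_0_lt_compat.
  by lra.
have -> : (16 / e * (- 2 * ln r) = 16 * (- 2 * ln r) / e)%R by field; lra.
apply: Rmult_le_compat_l; first lra.
exact: Rinv_le_contravar.
Qed.

Lemma llr_mean_sqr_le (p q : R) : (0 < p < 1)%R -> (0 < q < 1)%R ->
  (llr_mean p q ^ 2 <= llr_sqmean p q)%R.
Proof.
move=> p01 q01; have := tilt_sum p01 q01.
have := tilt_ge0 true p01 q01; have := tilt_ge0 false p01 q01.
rewrite /llr_mean /llr_sqmean.
move: (tilt p q true) (tilt p q false) (llr p q true) (llr p q false) => w w' x y w'0 w0 w1.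
have -> : w' = (1 - w)%R by lra.
(* The difference of the two sides, which is the variance of a two-point law. *)
have : (0 <= w * (1 - w) * (x - y) ^ 2)%R.
  apply: Rmult_le_pos; last exact: pow2_ge_0.
  by apply: Rmult_le_pos; lra.
by lra.
Qed.

Lemma llr_meanN (p q : R) : (0 < p < 1)%R -> (0 < q < 1)%R ->
  (llr_mean q p = - llr_mean p q)%R.
Proof. by move=> p01 q01; rewrite /llr_mean !(tiltC q p) !(llrN _ p01 q01); ring. Qed.

Lemma llr_sqmeanC (p q : R) : (0 < p < 1)%R -> (0 < q < 1)%R ->
  llr_sqmean q p = llr_sqmean p q.
Proof. by move=> p01 q01; rewrite /llr_sqmean !(tiltC q p) !(llrN _ p01 q01); ring. Qed.

(** * Testing two block-model assignments *)

Definition upper (n : nat) : {pred 'I_n * 'I_n} :=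
  [pred p | (nat_of_ord p.1 < nat_of_ord p.2)%N].
Arguments upper : clear implicits.

Definition edge (n : nat) := {p : 'I_n * 'I_n | p \in upper n}.

(** The entry is looked up at [p], then at the transposed pair, and is [false] on the diagonal. This
    is a bijection onto the adjacency matrices that turns [probA] into a product law over free
    coordinates. *)
Definition adj_of (n : nat) (B : {ffun edge n -> bool}) : adjmat n :=
  [ffun p => oapp B (oapp B false (insub (p.2, p.1))) (insub p)].

Lemma adj_of_upper (n : nat) (B : {ffun edge n -> bool}) (x : edge n) :
  adj_of B (val x) = B x.
Proof. by rewrite ffunE valK. Qed.

Lemma adj_of_adj (n : nat) (B : {ffun edge n -> bool}) : is_adj (adj_of B).
Proof.
have lt_some (i j : 'I_n) : (i < j)%N -> exists x : edge n, insub (i, j) = Some x.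
  by move=> ij; case: insubP => [x|]; [exists x | rewrite inE /= ij].
have ge_none (i j : 'I_n) : (j <= i)%N -> insub (i, j) = None :> option (edge n).
  by move=> ji; rewrite insubF // inE /= ltnNge ji.
apply/forallP => i; apply/forallP => j; rewrite !ffunE.
case: (ltngtP i j) => ij.
- have [x ->] := lt_some _ _ ij; rewrite ge_none 1?ltnW //= eqxx.
  by rewrite -val_eqE ltn_eqF.
- have [x ->] := lt_some _ _ ij; rewrite ge_none 1?ltnW //= eqxx.
  by rewrite -val_eqE gtn_eqF.
- by rewrite !ge_none /= ?ij // implybT.
Qed.

Lemma adj_of_restrict (n : nat) (A : adjmat n) : is_adj A ->
  adj_of [ffun x : edge n => A (val x)] = A.
Proof.
move=> /forallP adjA; apply/ffunP => -[i j]; rewrite ffunE.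
have /andP[/eqP symA diagA] := forallP (adjA i) j.
rewrite -[((i, j).2, (i, j).1)]/(j, i).
case: (@insubP _ _ (edge n) (i, j)) => [x _ <-|] /=; first by rewrite ffunE.
rewrite inE /= -leqNgt => ji; case: insubP => [x _ vx|] /=; first by rewrite ffunE vx symA.
rewrite inE /= -leqNgt => ij.
have ij' : i == j by rewrite -val_eqE eqn_leq ij ji.
by move: diagA; rewrite ij' /= => /negbTE.
Qed.

Lemma sum_adj (n : nat) (F : adjmat n -> R) :
  \big[Rplus/0%R]_(A | is_adj A) F A
  = \big[Rplus/0%R]_(B : {ffun edge n -> bool}) F (adj_of B).
Proof.
rewrite (reindex_onto (@adj_of n) (fun A => [ffun x => A (val x)])).
  apply: eq_bigl => B; rewrite adj_of_adj; apply/eqP/ffunP => x.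
  by rewrite ffunE adj_of_upper.
exact: adj_of_restrict.
Qed.

Lemma probA_adj_of (n K : nat) (a b : R) (s : assignment n K) (B : {ffun edge n -> bool}) :
  probA a b s (adj_of B)
  = \big[Rmult/1%R]_(x : edge n) bern (theta a b s (val x).1 (val x).2) (B x).
Proof.
rewrite /probA (big_sub (upper n)
  (fun p => if adj_of B p then theta a b s p.1 p.2 else (1 - theta a b s p.1 p.2)%R)).
by apply: eq_bigr => x _; rewrite adj_of_upper /bern.
Qed.

(** The pairs whose edge probability changes from [a / n] to [b / n] when [s] is replaced by
    [s']. *)
Definition split_edges (n K : nat) (s s' : assignment n K) : nat :=
  #|[pred p in upper n | (s p.1 == s p.2) && (s' p.1 != s' p.2)]|.

Lemma sum_edges_indic (n : nat) (P Q : pred ('I_n * 'I_n)) (c d : R) :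
  \big[Rplus/0%R]_(x : edge n)
     ((if P (val x) then c else 0) + (if Q (val x) then d else 0))%R
  = (INR #|[pred p in upper n | P p]| * c + INR #|[pred p in upper n | Q p]| * d)%R.
Proof.
rewrite big_split /= -(big_sub (upper n) (fun p => if P p then c else 0%R)).
by rewrite -(big_sub (upper n) (fun p => if Q p then d else 0%R)) !Rsum_indic.
Qed.

Lemma exp_ln_affinity (p q : R) (k : nat) : (0 < p < 1)%R -> (0 < q < 1)%R ->
  exp (INR k * ln (affinity p q)) = (affinity p q ^ k)%R.
Proof. by move=> p01 q01; rewrite -ln_pow ?exp_ln //; try apply: pow_lt; exact: affinity_gt0. Qed.

Lemma sbm_testing (n K : nat) (a b t : R) (s s' : assignment n K) :
  (0 < a / INR n < 1)%R -> (0 < b / INR n < 1)%R -> (0 < t)%R ->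
  ((INR (split_edges s s') + INR (split_edges s' s)) * llr_sqmean (a / INR n) (b / INR n)
   + ((INR (split_edges s s') - INR (split_edges s' s)) * llr_mean (a / INR n) (b / INR n)) ^ 2
   <= t ^ 2)%R ->
  (affinity (a / INR n) (b / INR n) ^ (split_edges s s' + split_edges s' s) * exp (- t / 2)
   <= \big[Rplus/0%R]_(A | is_adj A) Rmin (probA a b s A) (probA a b s' A))%R.
Proof.
set p := (a / INR n)%R; set q := (b / INR n)%R => p01 q01 t0 ht.
pose th (s : assignment n K) (x : edge n) := theta a b s (val x).1 (val x).2.
have th01 (u : assignment n K) x : (0 < th u x < 1)%R by rewrite /th /theta -/p -/q; case: ifP.
pose sp (s s' : assignment n K) (p : 'I_n * 'I_n) := (s p.1 == s p.2) && (s' p.1 != s' p.2).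
have thE (u u' : assignment n K) (x : edge n) : sp u u' (val x) -> th u x = p /\ th u' x = q.
  by rewrite /th /theta -/p -/q => /andP[-> /negbTE ->].
have thD (x : edge n) : ~~ sp s s' (val x) -> ~~ sp s' s (val x) -> th s x = th s' x.
  by rewrite /sp /th /theta; do 2 case: eqP.
have spN (x : edge n) : sp s s' (val x) -> ~~ sp s' s (val x).
  by rewrite /sp => /andP[-> _]; rewrite andbF.
(* Pairs with equal probabilities under [s] and [s'] contribute nothing to a sum of [f], which
   vanishes on the diagonal. It serves for the log-affinity and both moments; the means have
   opposite signs on the two kinds of split pairs, hence the difference of counts in the
   hypothesis. *)
have spE (f : R -> R -> R) : (forall r, (0 < r < 1)%R -> f r r = 0%R) ->
    \big[Rplus/0%R]_(x : edge n) f (th s x) (th s' x)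
    = (INR (split_edges s s') * f p q + INR (split_edges s' s) * f q p)%R.
  move=> f0; rewrite /split_edges -sum_edges_indic; apply: eq_bigr => x _.
  rewrite -/(sp s s' (val x)) -/(sp s' s (val x)).
  case: ifPn => h1; first by rewrite (negbTE (spN x h1)); case: (thE s s' x h1) => -> ->; ring.
  case: ifPn => h2; first by case: (thE s' s x h2) => -> ->; ring.
  by rewrite (thD x h1 h2) f0 //; ring.
have prod_aff : \big[Rmult/1%R]_(x : edge n) affinity (th s x) (th s' x)
    = (affinity p q ^ (split_edges s s' + split_edges s' s))%R.
  transitivity (\big[Rmult/1%R]_(x : edge n) exp (ln (affinity (th s x) (th s' x)))).
    by apply: eq_bigr => x _; rewrite exp_ln //; exact: affinity_gt0.
  rewrite Rprod_exp (spE (fun x y => ln (affinity x y))); last first.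
    by move=> r r01; rewrite affinity_diag // ln_1.
  by rewrite (affinityC q p) -exp_ln_affinity // plus_INR; congr exp; ring.
have := @testing_affinity _ (fun x => affinity (th s x) (th s' x))
  (fun x => tilt (th s x) (th s' x)) (fun x => llr (th s x) (th s' x)) t t0.
rewrite prod_aff sum_adj => H; apply: Rle_trans (H _ _ _ _) _.
- by move=> x; exact/Rlt_le/affinity_gt0.
- by move=> x c; exact: tilt_ge0.
- by move=> x; exact: tilt_sum.
- rewrite (spE llr_sqmean) => [|r r01]; last by rewrite /llr_sqmean !llr_diag //; ring.
  rewrite (spE llr_mean) => [|r r01]; last by rewrite /llr_mean !llr_diag //; ring.
  by rewrite (llr_meanN p01 q01) (llr_sqmeanC p01 q01); lra.
apply: Req_le; apply: eq_bigr => B _; rewrite !probA_adj_of.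
congr Rmin; apply: eq_bigr => x _; first by rewrite bern_tilt.
rewrite -[RHS](bern_tilt (B x) (th01 s' x) (th01 s x)) affinityC tiltC.
by rewrite (llrN _ (th01 s x) (th01 s' x)).
Qed.

(** Every pair satisfying [P] contains [i], and [upper] keeps one orientation of each pair, so
    sending a pair to its endpoint other than [i] is a bijection. *)
Lemma card_star (n : nat) (i : 'I_n) (C : pred 'I_n) (P : pred ('I_n * 'I_n)) :
  (forall j, P (i, j) = C j) -> (forall j, P (j, i) = C j) ->
  (forall p, p.1 != i -> p.2 != i -> ~~ P p) ->
  #|[pred p in upper n | P p]| = #|[pred j | (j != i) && C j]|.
Proof.
move=> P1 P2 P0; pose oth (p : 'I_n * 'I_n) := if p.1 == i then p.2 else p.1.
rewrite -(@card_in_imset _ _ oth) => [|[u v] [u' v']]; last first.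
  rewrite !inE /oth /= => /andP[uv Puv] /andP[uv' Puv'].
  have := P0 (u, v); have := P0 (u', v'); rewrite Puv Puv' /=.
  case: (u =P i) uv => [->|_] uv; case: (u' =P i) uv' => [->|_] uv' //=.
  - by move=> _ _ ->.
  - case: (v' =P i) uv' => [-> /= uv' _ _ vE|_ _ /(_ isT isT)] //.
    by move: uv'; rewrite -vE ltnNge ltnW.
  - case: (v =P i) uv => [-> /= uv _ _ vE|_ _ _ /(_ isT isT)] //.
    by move: uv; rewrite vE ltnNge ltnW.
  - case: (v =P i) => [->|_ _ /(_ isT isT)] //; case: (v' =P i) => [-> _ _ ->|_ /(_ isT isT)] //.
apply: eq_card => j; rewrite !inE; apply/imsetP/andP => [[[u v]]|[ji Cj]].
  rewrite !inE /oth /= => /andP[uv Puv] ->.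
  have := P0 (u, v); rewrite Puv /=.
  case: (u =P i) uv Puv => [->|/eqP ui] uv Puv /=.
    by move=> _; rewrite -P1 Puv -val_eqE; split=> //; rewrite neq_ltn uv orbT.
  by case: (v =P i) Puv => [-> Puv _|_ _ /(_ isT isT)] //; rewrite ui -P2 Puv.
case: (ltngtP j i) ji => [ji _|ij _|/val_inj ->]; last by rewrite eqxx.
- exists (j, i); first by rewrite !inE /= ji P2.
  by rewrite /oth /=; case: eqP.
- exists (i, j); first by rewrite !inE /= ij P1.
  by rewrite /oth /= eqxx.
Qed.

(** * The support of the prior *)

(* Communities [k < K./2] are matched with [k + K./2]; for odd [K] the last
   community is its own partner. *)
Definition partner_nat (K k : nat) : nat :=
  if (k < K./2)%N then (k + K./2)%N else if (k < (K./2).*2)%N then (k - K./2)%N else k.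

Definition partner (K : nat) (k : 'I_K) : 'I_K := insubd k (partner_nat K k).

Definition lower_half (K : nat) (k : 'I_K) : bool := (k < K./2)%N.

Lemma val_partner (K : nat) (k : 'I_K) : nat_of_ord (partner k) = partner_nat K k.
Proof.
suff lt : (partner_nat K k < K)%N by rewrite -[LHS]/(val _) val_insubd lt.
by rewrite /partner_nat; have := ltn_ord k; repeat case: ifP; lia.
Qed.

Lemma partnerK (K : nat) : involutive (@partner K).
Proof.
move=> k; apply: val_inj; rewrite /= !val_partner /partner_nat.
by have := ltn_ord k; repeat case: ifP; rewrite /=; lia.
Qed.

Lemma partner_fixE (K : nat) (k : 'I_K) :
  (partner k == k) = ~~ (lower_half k || lower_half (partner k)).
Proof.
rewrite -val_eqE /lower_half /= val_partner /partner_nat.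
by have := ltn_ord k; repeat case: ifP; lia.
Qed.

Lemma lower_half_partner (K : nat) (k : 'I_K) : lower_half k -> ~~ lower_half (partner k).
Proof. by rewrite /lower_half val_partner /partner_nat => ->; lia. Qed.

Lemma card_lower_half (K : nat) : #|[pred k : 'I_K | lower_half k]| = K./2.
Proof.
have leK : (K./2 <= K)%N by lia.
by rewrite -sum1_card -(big_ord_widen K (fun=> 1%N) leK) sum_nat_const card_ord muln1.
Qed.

(* The known nodes keep their label in [s0]; within each matched pair of
   communities the sizes are those of [s0], up to one node moved into the
   first community. *)
Definition near_base (n K : nat) (kn : pred 'I_n) (s0 s : assignment n K) : bool :=
  [forall i, kn i ==> (s i == s0 i)] &&
  [forall k, if partner k == k then comm_size s k == comm_size s0 k
    else lower_half k ==>
      [&& comm_size s k == comm_size s0 k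
        & comm_size s (partner k) == comm_size s0 (partner k)]
      || [&& comm_size s k == (comm_size s0 k).+1
        & (comm_size s (partner k)).+1 == comm_size s0 (partner k)]].

Definition flip (n K : nat) (i : 'I_n) (s : assignment n K) : assignment n K :=
  [ffun j => if j == i then partner (s j) else s j].

(** Asking both [s] and its flip to lie in the support makes the condition invariant under the flip,
    so that sums over [s] can be reindexed by it. *)
Definition movable (n K : nat) (kn : pred 'I_n) (s0 s : assignment n K) (i : 'I_n) : bool :=
  [&& ~~ kn i, partner (s i) != s i, near_base kn s0 s & near_base kn s0 (flip i s)].

Lemma near_base_known (n K : nat) (kn : pred 'I_n) (s0 s : assignment n K) (i : 'I_n) :
  near_base kn s0 s -> kn i -> s i = s0 i.
Proof. by move=> /andP[/forallP/(_ i)/implyP H _] /H/eqP. Qed.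

Lemma near_base_pair (n K : nat) (kn : pred 'I_n) (s0 s : assignment n K) (k : 'I_K) :
  near_base kn s0 s -> lower_half k ->
  comm_size s k = comm_size s0 k /\ comm_size s (partner k) = comm_size s0 (partner k)
  \/ comm_size s k = (comm_size s0 k).+1
     /\ (comm_size s (partner k)).+1 = comm_size s0 (partner k).
Proof.
move=> /andP[_ /forallP/(_ k)] + lk; rewrite partner_fixE lk /=.
by case/orP=> /andP[/eqP ? /eqP ?]; [left | right].
Qed.

Lemma near_base_size (n K : nat) (kn : pred 'I_n) (s0 s : assignment n K) (k : 'I_K) :
  near_base kn s0 s ->
  (comm_size s0 k <= (comm_size s k).+1 /\ comm_size s k <= (comm_size s0 k).+1)%N.
Proof.
move=> Ss; case: (boolP (lower_half k)) => [/(near_base_pair Ss)|lk]; first lia.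
case: (boolP (lower_half (partner k))) => [/(near_base_pair Ss)|lpk].
  by rewrite partnerK; lia.
move: Ss => /andP[_ /forallP/(_ k)].
by rewrite partner_fixE (negbTE lk) (negbTE lpk) /= => /eqP ->.
Qed.

Lemma near_base_pair_sum (n K : nat) (kn : pred 'I_n) (s0 s : assignment n K) (k : 'I_K) :
  near_base kn s0 s -> partner k != k ->
  (comm_size s k + comm_size s (partner k)
   = comm_size s0 k + comm_size s0 (partner k))%N.
Proof.
move=> Ss; rewrite partner_fixE negbK => /orP[] /(near_base_pair Ss); first lia.
by rewrite partnerK; lia.
Qed.

Lemma near_base_refl (n K : nat) (kn : pred 'I_n) (s0 : assignment n K) : near_base kn s0 s0.
Proof.
apply/andP; split; apply/forallP => x; first by rewrite eqxx implybT.
by rewrite !eqxx /=; case: ifP => // _; rewrite implybT.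
Qed.

Lemma flipK (n K : nat) (i : 'I_n) : involutive (@flip n K i).
Proof.
by move=> s; apply/ffunP => j; rewrite !ffunE; case: eqP => // _; rewrite partnerK.
Qed.

Lemma flip_same (n K : nat) (i : 'I_n) (s : assignment n K) : flip i s i = partner (s i).
Proof. by rewrite ffunE eqxx. Qed.

Lemma flip_other (n K : nat) (i j : 'I_n) (s : assignment n K) : j != i -> flip i s j = s j.
Proof. by rewrite ffunE => /negbTE ->. Qed.

Lemma movable_flip (n K : nat) (kn : pred 'I_n) (s0 s : assignment n K) (i : 'I_n) :
  movable kn s0 (flip i s) i = movable kn s0 s i.
Proof.
rewrite /movable flipK flip_same partnerK eq_sym; congr (_ && (_ && _)).
exact: andbC.
Qed.

Lemma comm_size_minus (n K : nat) (s : assignment n K) (i : 'I_n) (k : 'I_K) :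
  comm_size s k = ((s i == k) + #|[pred j | (j != i) && (s j == k)]|)%N.
Proof.
rewrite /comm_size (cardsD1 i) inE; congr (_ + _)%N.
by apply: eq_card => j; rewrite !inE.
Qed.

Lemma comm_size_flip (n K : nat) (s : assignment n K) (i : 'I_n) (k : 'I_K) :
  (comm_size (flip i s) k + (s i == k) = comm_size s k + (partner (s i) == k))%N.
Proof.
rewrite (comm_size_minus s i) (comm_size_minus (flip i s) i) flip_same.
have -> : #|[pred j | (j != i) && (flip i s j == k)]| = #|[pred j | (j != i) && (s j == k)]|.
  by apply: eq_card => j; rewrite !inE; case: eqP => //= /eqP ji; rewrite flip_other.
by lia.
Qed.

(** The pairs broken by the flip join [i] to the other members of its community; the successor
    accounts for [i] itself. *)
Lemma split_edges_flip (n K : nat) (s : assignment n K) (i : 'I_n) : partner (s i) != s i ->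
  (split_edges s (flip i s)).+1 = comm_size s (s i).
Proof.
move=> pi; rewrite (comm_size_minus s i) eqxx add1n; congr _.+1.
rewrite /split_edges.
rewrite (@card_star _ i (fun j => (j != i) && (s j == s i))
  (fun p => (s p.1 == s p.2) && (flip i s p.1 != flip i s p.2))).
- by apply: eq_card => j; rewrite !inE andbA andbb.
- move=> j /=; rewrite flip_same; case: (j =P i) => [->|/eqP ji] /=.
    by rewrite flip_same !eqxx.
  by rewrite flip_other // [s j == _]eq_sym; case: eqP => //= <-.
- move=> j /=; rewrite flip_same; case: (j =P i) => [->|/eqP ji] /=.
    by rewrite flip_same !eqxx.
  by rewrite flip_other //; case: eqP => //= ->; rewrite eq_sym.
- move=> [u v] /= ui vi; rewrite !flip_other //; by case: eqP.
Qed.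

(** The previous count applied to the flipped assignment, where [i] is the additional member of the
    partner community; the two shifts by one cancel. *)
Lemma split_edges_unflip (n K : nat) (s : assignment n K) (i : 'I_n) : partner (s i) != s i ->
  split_edges (flip i s) s = comm_size s (partner (s i)).
Proof.
move=> pi; have pi' : partner (flip i s i) != flip i s i.
  by rewrite flip_same partnerK eq_sym.
have := split_edges_flip pi'; rewrite flipK flip_same.
have := comm_size_flip s i (partner (s i)).
by rewrite eqxx eq_sym (negbTE pi); lia.
Qed.

Definition anchored (n K : nat) (kn : pred 'I_n) (s0 : assignment n K) (h : nat) : Prop :=
  forall k, #|[set i | kn i & s0 i == k]| = h.

Definition balanced (n K : nat) (s0 : assignment n K) (m : nat) : Prop :=
  forall k, (m <= comm_size s0 k <= m.+1)%N.

Lemma card_unknown (n K : nat) (kn : pred 'I_n) (s0 s : assignment n K) (h : nat) (k : 'I_K) :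
  anchored kn s0 h -> near_base kn s0 s ->
  comm_size s k = (h + #|[set i | ~~ kn i & s i == k]|)%N.
Proof.
move=> anc Ss; rewrite -(anc k) /comm_size.
rewrite -(cardsID [set i | kn i]); congr (_ + _)%N; apply: eq_card => i; rewrite !inE.
  by case: (boolP (kn i)) => //= [/(near_base_known Ss) ->|_]; rewrite ?andbT ?andbF.
by [].
Qed.

Lemma card_set_sum (T I : finType) (P : pred T) (f : T -> I) (V : {set I}) :
  #|[set i | P i & f i \in V]| = \sum_(k in V) #|[set i | P i & f i == k]|.
Proof.
rewrite -sum1_card (partition_big f (mem V)) /= => [|i]; last by rewrite inE => /andP[].
apply: eq_bigr => k kV; rewrite sum1dep_card; apply: eq_card => i; rewrite !inE.
by case: (f i =P k) => [->|]; rewrite ?kV ?andbF // !andbT.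
Qed.

(** The error on the known nodes is expressed through [s0], hence is the same for all [s] in the
    support; this allows an alignment chosen from [t] alone. *)
Lemma hamming_known_split (n K : nat) (kn : pred 'I_n) (s0 s t : assignment n K) (d : {perm 'I_K}) :
  near_base kn s0 s ->
  hamming_perm s t d = (#|[set i | kn i & s0 i != d (t i)]|
                        + #|[set i | ~~ kn i & s i != d (t i)]|)%N.
Proof.
move=> Ss; rewrite /hamming_perm -(cardsID [set i | kn i]); congr (_ + _)%N.
  apply: eq_card => i; rewrite !inE.
  by case: (boolP (kn i)) => [/(near_base_known Ss) ->|_]; rewrite ?andbT ?andbF.
by apply: eq_card => i; rewrite !inE.
Qed.

(* The alignment [d] of an estimate with the known nodes does not depend on
   [s]. Any other alignment [d'] moves some set [V] of communities, and since
   each known node of [V] is misclassified by [d] or [d'], it costs at least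
   [#|V| * h / 2]. *)
Lemma alignment (n K m h : nat) (kn : pred 'I_n) (s0 t : assignment n K) :
  anchored kn s0 h -> balanced s0 m -> (m.+2 <= 3 * h)%N ->
  exists d : {perm 'I_K}, forall s, near_base kn s0 s ->
    forall d' : {perm 'I_K}, (hamming_perm s t d <= 5 * hamming_perm s t d')%N.
Proof.
move=> anc bal mh.
pose kerr (d : {perm 'I_K}) := #|[set i | kn i & s0 i != d (t i)]|.
(* The permutation with the fewest errors on the known nodes. *)
pose d : {perm 'I_K} := [arg min_(d < 1%g) kerr d]; exists d => s Ss d'.
have dmin : (kerr d <= kerr d')%N by rewrite /d; case: arg_minnP => // d1 _; apply.
rewrite !(hamming_known_split _ _ Ss) -/(kerr d) -/(kerr d').
pose V := [set v | (d^-1)%g v != (d'^-1)%g v].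
(* A known node labelled correctly by both permutations has a label with the same preimage under
   both, hence outside [V]. *)
have hV : (#|V| * h <= kerr d + kerr d')%N.
  have -> : (#|V| * h = #|[set i | kn i & s0 i \in V]|)%N.
    by rewrite card_set_sum (eq_bigr _ (fun k _ => anc k)) sum_nat_const.
  apply: leq_trans (leq_card_setU _ _); apply: subset_leq_card.
  apply/subsetP => i; rewrite !inE => /andP[-> /=].
  rewrite -negb_and; apply: contraNN => /andP[/eqP e1 /eqP e2].
  by rewrite {1}e1 e2 !permK.
have hU : (#|[set i | ~~ kn i & s i != d (t i)]| <= #|[set i | ~~ kn i & s i != d' (t i)]|
    + #|[set i | ~~ kn i & s i \in V]|)%N.
  apply: leq_trans (leq_card_setU _ _); apply: subset_leq_card.
  apply/subsetP => i; rewrite !inE => /andP[-> /=] sd.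
  case: eqP => //= sd'; apply: contraNN sd => /eqP e.
  by rewrite -[s i](permKV d) e {1}sd' permK.
(* A community has at most [m + 2 <= 3 * h] nodes, of which [h] are known. *)
have hX : (#|[set i | ~~ kn i & s i \in V]| <= #|V| * (2 * h))%N.
  rewrite card_set_sum -sum_nat_const; apply: leq_sum => k _.
  have /andP[_ c1] := bal k; have [_ c2] := near_base_size k Ss.
  rewrite -(leq_add2l h) -(card_unknown k anc Ss); lia.
(* By [dmin], [#|V| * h] is at most [2 * kerr d'], so unknown errors grow by at most [4 * kerr d']
   and known errors stay at most [kerr d']: the factor is 5. *)
by lia.
Qed.

(** A flip changes only the two sizes of one matched pair, so the size condition has to be checked
    again for that pair only. *)
Lemma near_base_flip (n K : nat) (kn : pred 'I_n) (s0 s : assignment n K) (i : 'I_n) (k : 'I_K) :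
  near_base kn s0 s -> ~~ kn i -> lower_half k -> s i \in [:: k; partner k] ->
  let s' := flip i s in
  [&& comm_size s' k == comm_size s0 k & comm_size s' (partner k) == comm_size s0 (partner k)]
  || [&& comm_size s' k == (comm_size s0 k).+1
      & (comm_size s' (partner k)).+1 == comm_size s0 (partner k)] ->
  near_base kn s0 s'.
Proof.
move=> Ss ki lk sik s' Hk.
have pk : partner k != k by rewrite partner_fixE lk.
have other l : l != k -> l != partner k -> comm_size s' l = comm_size s l.
  move=> /negbTE lk1 /negbTE lk2; have := comm_size_flip s i l; rewrite -/s'.
  by move: sik; rewrite !inE => /orP[] /eqP ->; rewrite ?partnerK ![_ == l]eq_sym lk1 lk2; lia.
case/andP: (Ss) => /forallP kns /forallP szs; apply/andP; split; apply/forallP => l.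
  apply/implyP => kl; rewrite flip_other; first exact: implyP (kns l) kl.
  by apply: contraNneq ki => <-.
case: (l =P k) => [->|/eqP lnk]; first by rewrite (negbTE pk) lk.
move: (szs l); case: eqP => [pl|_] szl.
  rewrite other //; apply: contraNneq pk => lE.
  by rewrite -[X in _ == X]partnerK -lE pl.
apply/implyP => ll; move: szl; rewrite ll /=.
have lnp : l != partner k by apply: contraTneq ll => ->; exact: lower_half_partner.
rewrite !other //; last by rewrite (inj_eq (inv_inj (@partnerK K))).
by apply: contraNneq lnp => <-; rewrite partnerK.
Qed.

(** If the sizes are those of [s0], every unknown node of [partner k] may move into [k]; if one node
    has already moved, every unknown node of [k] may move back. In both cases the source community
    has at least [m] nodes, [h] of them known. *)
Lemma card_movable_pair (n K m h : nat) (kn : pred 'I_n) (s0 s : assignment n K) (k : 'I_K) :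
  anchored kn s0 h -> balanced s0 m -> near_base kn s0 s -> lower_half k ->
  (m - h <= #|[set i | movable kn s0 s i & s i \in [:: k; partner k]]|)%N.
Proof.
move=> anc bal Ss lk; have pk : partner k != k by rewrite partner_fixE lk.
have mov (l : 'I_K) : l \in [:: k; partner k] -> (m <= comm_size s l)%N ->
   (forall i, ~~ kn i -> s i = l -> near_base kn s0 (flip i s)) ->
   (m - h <= #|[set i | movable kn s0 s i & s i \in [:: k; partner k]]|)%N.
  move=> lk2 ml nb; apply: (@leq_trans #|[set i | ~~ kn i & s i == l]|).
    by have := card_unknown l anc Ss; lia.
  apply: subset_leq_card; apply/subsetP => i; rewrite inE => /andP[ki /eqP sil].
  rewrite inE /movable ki Ss nb // sil lk2 !andbT /=.
  by move: lk2; rewrite !inE => /orP[] /eqP ->; rewrite ?partnerK // eq_sym.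
have balk := bal k; have balp := bal (partner k).
case: (near_base_pair Ss lk) => -[ek ep].
  apply: (mov (partner k)); rewrite ?inE ?eqxx ?orbT //; first lia.
  move=> i ki sip; apply: (near_base_flip Ss ki lk); first by rewrite sip !inE eqxx orbT.
  have := comm_size_flip s i k; have := comm_size_flip s i (partner k).
  by rewrite sip partnerK !eqxx (negbTE pk) eq_sym (negbTE pk); lia.
apply: (mov k); rewrite ?inE ?eqxx ?orbT //; first lia.
move=> i ki sik; apply: (near_base_flip Ss ki lk); first by rewrite sik !inE eqxx.
have := comm_size_flip s i k; have := comm_size_flip s i (partner k).
by rewrite sik !eqxx (negbTE pk) eq_sym (negbTE pk); lia.
Qed.

Lemma card_movable (n K m h : nat) (kn : pred 'I_n) (s0 s : assignment n K) :
  anchored kn s0 h -> balanced s0 m -> near_base kn s0 s ->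
  (K./2 * (m - h) <= #|[pred i | movable kn s0 s i]|)%N.
Proof.
move=> anc bal Ss; rewrite -card_lower_half -sum_nat_const (eq_bigl (@lower_half K)) //.
(* Movable nodes are grouped by the first community of their matched pair. *)
pose low i := if lower_half (s i) then s i else partner (s i).
rewrite -[leqRHS]sum1_card.
rewrite (partition_big low (fun k => lower_half k)) /=; last first.
  move=> i; rewrite inE => /and4P[_ + _ _]; rewrite partner_fixE negbK /low.
  by case: (boolP (lower_half (s i))).
apply: leq_sum => k lk; apply: leq_trans (card_movable_pair anc bal Ss lk) _.
rewrite sum1dep_card; apply: subset_leq_card; apply/subsetP => i.
rewrite !inE => /andP[-> /=] /orP[] /eqP si; rewrite /low si ?lk //.
by rewrite (negbTE (lower_half_partner lk)) partnerK.
Qed.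

(** Labels are dealt cyclically, so the first [Q * K] nodes contain each label exactly [Q] times;
    such a prefix serves as the set of known nodes. *)
Definition base_assignment (n K : nat) (K0 : (0 < K)%N) : assignment n K :=
  [ffun i : 'I_n => Ordinal (ltn_pmod i K0)].
Arguments base_assignment n [K] K0.

Lemma card_mod_class_le (n K Q : nat) (K0 : (0 < K)%N) (k : 'I_K) :
  (#|[set i : 'I_n | (i < Q * K)%N & base_assignment n K0 i == k]| <= Q)%N.
Proof.
case: Q => [|Q].
  by rewrite eq_card0 // => i; rewrite !inE mul0n ltn0.
rewrite -[leqRHS]card_ord.
rewrite -(@card_in_imset _ _ (fun i : 'I_n => inord (i %/ K) : 'I_Q.+1)).
  exact: max_card.
move=> i j; rewrite !inE !ffunE => /andP[iQ /eqP ik] /andP[jQ /eqP jk] /(congr1 val).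
rewrite /= !inordK ?ltn_divLR // => ij; apply: val_inj.
have /= ik' := congr1 val ik; have /= jk' := congr1 val jk.
by rewrite /= [LHS](divn_eq i K) [RHS](divn_eq j K) ij ik' jk'.
Qed.

Lemma card_mod_class_ge (n K Q : nat) (K0 : (0 < K)%N) (k : 'I_K) : (Q * K <= n)%N ->
  (Q <= #|[set i : 'I_n | (i < Q * K)%N & base_assignment n K0 i == k]|)%N.
Proof.
move=> Qn.
have lt (x : 'I_Q) : (x * K + k < Q * K)%N.
  apply: (@leq_trans (x * K + K)); first by rewrite ltn_add2l.
  by rewrite -mulSnr leq_mul2r ltn_ord orbT.
rewrite -[leqLHS]card_ord.
pose f (x : 'I_Q) : 'I_n := Ordinal (leq_trans (lt x) Qn).
rewrite -(@card_imset _ _ f); last first.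
  move=> x y /(congr1 val) /= /eqP; rewrite eqn_add2r eqn_mul2r gtn_eqF //= => /eqP.
  exact: val_inj.
apply: subset_leq_card; apply/subsetP => i /imsetP[x _ ->].
rewrite inE ffunE /= lt; apply/eqP/val_inj => /=.
by rewrite modnMDl modn_small.
Qed.

Lemma base_anchored (n K Q : nat) (K0 : (0 < K)%N) : (Q * K <= n)%N ->
  anchored (fun i : 'I_n => (i < Q * K)%N) (base_assignment n K0) Q.
Proof.
by move=> Qn k; apply/eqP; rewrite eqn_leq card_mod_class_le card_mod_class_ge.
Qed.

Lemma base_balanced (n K : nat) (K0 : (0 < K)%N) :
  balanced (base_assignment n K0) (n %/ K).
Proof.
move=> k; apply/andP; split.
  apply: leq_trans (@card_mod_class_ge n K _ K0 k (leq_divM n K)) _.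
  by apply: subset_leq_card; apply/subsetP => i; rewrite !inE => /andP[].
apply: leq_trans (@card_mod_class_le n K _ K0 k); apply: subset_leq_card.
apply/subsetP => i; rewrite !inE => ->; rewrite andbT.
by apply: ltn_trans (ltn_ord i) _; exact: ltn_ceil.
Qed.

(** * Averaging over the prior *)

Lemma le_bigRmax (I : finType) (P : pred I) (F : I -> R) (i : I) :
  P i -> (F i <= \big[Rmax/0%R]_(j | P j) F j)%R.
Proof.
move=> Pi; have := mem_index_enum i; elim: (index_enum I) => // j r IH.
rewrite inE big_cons => /orP[/eqP <-|/IH ir]; first by rewrite Pi; exact: Rmax_l.
by case: ifP => // _; apply: Rle_trans ir (Rmax_r _ _).
Qed.

Lemma INR_card (I : finType) (P : pred I) :
  INR #|[set i | P i]| = \big[Rplus/0%R]_i (if P i then 1 else 0)%R.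
Proof. by rewrite Rsum_indic Rmult_1_r cardsE. Qed.

Lemma mismatch_ge (n K c : nat) (s t : assignment n K) (d : {perm 'I_K}) : (0 < n)%N ->
  (forall d' : {perm 'I_K}, hamming_perm s t d <= c.+1 * hamming_perm s t d')%N ->
  (INR (hamming_perm s t d) <= INR c.+1 * INR n * mismatch s t)%R.
Proof.
move=> n0 hd; have nR : (0 < INR n)%R by apply/lt_0_INR/ltP.
rewrite /mismatch; set mn := \big[minn/n]_d' _.
have le_mn : (hamming_perm s t d <= c.+1 * mn)%N.
  rewrite /mn; elim/big_ind: _ => [|x y hx hy|d' _]; last exact: hd.
    (* The default [n] of the minimum is harmless, since a Hamming distance is at most [n]. *)
    apply: (@leq_trans n); last by rewrite leq_pmull.
    by rewrite -[leqRHS]card_ord; exact: max_card.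
  by rewrite /minn; case: ifP.
have -> : (INR c.+1 * INR n * (INR mn / INR n) = INR (c.+1 * mn))%R.
  by rewrite mult_INR; field; lra.
exact/le_INR/leP.
Qed.

Lemma probA_ge0 (n K : nat) (a b : R) (s : assignment n K) (A : adjmat n) :
  (0 < a / INR n < 1)%R -> (0 < b / INR n < 1)%R -> (0 <= probA a b s A)%R.
Proof.
move=> pa pb; apply: Rprod_ge0 => p _; rewrite /theta.
by case: ifP => _; case: ifP => _; lra.
Qed.

(** The alignment [al] depends on the estimate only, so the errors at [i] under [s] and under its
    flip are judged with the same permutation. *)
Definition node_error (n K : nat) (a b : R) (q : estimator n K)
    (al : assignment n K -> {perm 'I_K}) (s : assignment n K) (i : 'I_n) : R :=
  \big[Rplus/0%R]_(A | is_adj A)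
    (probA a b s A *
     \big[Rplus/0%R]_t (q A t * (if s i != al t (t i) then 1 else 0)))%R.

Lemma sum_node_error_le (n K c : nat) (a b : R) (q : estimator n K)
    (al : assignment n K -> {perm 'I_K}) (s : assignment n K) :
  (0 < n)%N -> (0 < a / INR n < 1)%R -> (0 < b / INR n < 1)%R -> is_estimator q ->
  (forall t (d : {perm 'I_K}), hamming_perm s t (al t) <= c.+1 * hamming_perm s t d)%N ->
  (\big[Rplus/0%R]_i node_error a b q al s i <= INR c.+1 * INR n * risk a b q s)%R.
Proof.
move=> n0 pa pb [q0 _] hal.
have swap x y z : (x * (y * z) = y * (x * z))%R by ring.
rewrite /node_error exchange_big /risk big_distrr /=.
apply: Rsum_le => A _; rewrite -big_distrr /= exchange_big /=.
rewrite [X in (_ <= X)%R]swap.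
apply: Rmult_le_compat_l; first exact: probA_ge0.
rewrite big_distrr; apply: Rsum_le => t _ /=; rewrite -big_distrr /=.
rewrite -(INR_card (fun i => s i != al t (t i))).
rewrite [X in (_ <= X)%R]swap.
by apply: Rmult_le_compat_l => //; exact: mismatch_ge.
Qed.

(** The aligned label of [i] cannot equal both [s i] and [s' i], so for each [A] the two conditional
    error probabilities add up to at least 1. *)
Lemma testing_error (n K : nat) (a b : R) (q : estimator n K)
    (al : assignment n K -> {perm 'I_K}) (s s' : assignment n K) (i : 'I_n) :
  (0 < a / INR n < 1)%R -> (0 < b / INR n < 1)%R -> is_estimator q -> s i != s' i ->
  (\big[Rplus/0%R]_(A | is_adj A) Rmin (probA a b s A) (probA a b s' A)
   <= node_error a b q al s i + node_error a b q al s' i)%R.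
Proof.
move=> pa pb [q0 q1] ss'; rewrite /node_error -big_split; apply: Rsum_le => A _ /=.
set m := Rmin _ _.
have mge0 : (0 <= m)%R by apply: Rmin_glb; exact: probA_ge0.
pose err (u : assignment n K) :=
  \big[Rplus/0%R]_t (q A t * (if u i != al t (t i) then 1 else 0))%R.
change (m <= probA a b s A * err s + probA a b s' A * err s')%R.
have err0 u : (0 <= err u)%R.
  by apply: Rsum_ge0 => t _; have := q0 A t; case: ifP; lra.
have := Rmult_le_compat_r _ _ _ (err0 s) (Rmin_l _ _ : m <= probA a b s A)%R.
have := Rmult_le_compat_r _ _ _ (err0 s') (Rmin_r _ _ : m <= probA a b s' A)%R.
suff : (1 <= err s + err s')%R.
  by move=> /(Rmult_le_compat_l _ _ _ mge0); lra.
rewrite /err -big_split -[X in (X <= _)%R](q1 A); apply: Rsum_le => t _ /=; have := q0 A t.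
case: (s i =P _) => [<-|_] /=; last by case: ifP; lra.
by rewrite eq_sym ss'; lra.
Qed.

Lemma worst_risk_ge (n K m h : nat) (a b eta eps : R) (q : estimator n K)
    (kn : pred 'I_n) (s0 : assignment n K) :
  (0 < n)%N -> (0 < a / INR n < 1)%R -> (0 < b / INR n < 1)%R -> is_estimator q ->
  anchored kn s0 h -> balanced s0 m -> (m.+2 <= 3 * h)%N -> (0 <= eps)%R ->
  (forall s, near_base kn s0 s -> in_Theta0 eta s) ->
  (forall s i, movable kn s0 s i ->
     (eps <= \big[Rplus/0%R]_(A | is_adj A) Rmin (probA a b s A) (probA a b (flip i s) A))%R) ->
  (eps * INR (K./2 * (m - h)) <= 10 * INR n * worst_risk a b eta q)%R.
Proof.
move=> n0 pa pb qest anc bal mh eps0 inTh test.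
have [al hal] : exists al : assignment n K -> {perm 'I_K}, forall t s, near_base kn s0 s ->
    forall d : {perm 'I_K}, (hamming_perm s t (al t) <= 5 * hamming_perm s t d)%N.
  by have [al hal] := fin_all_exists (fun t => alignment t anc bal mh); exists al.
pose e := node_error a b q al; set M := (K./2 * (m - h))%N.
have e0 s i : (0 <= e s i)%R.
  apply: Rsum_ge0 => A _; apply: Rmult_le_pos; first exact: probA_ge0.
  by apply: Rsum_ge0 => t _; have := qest.1 A t; case: ifP; lra.
pose S := near_base kn s0; pose nS := INR #|[pred s | S s]|.
have nS0 : (0 < nS)%R.
  by apply/lt_0_INR/ltP/card_gt0P; exists s0; exact: near_base_refl.
have up : (\big[Rplus/0%R]_(s | S s) \big[Rplus/0%R]_i e s i
           <= nS * (5 * INR n * worst_risk a b eta q))%R.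
  rewrite -Rsum_const; apply: Rsum_le => s Ss.
  apply: (Rle_trans _ (5 * INR n * risk a b q s)%R).
    have -> : 5%R = INR 5 by rewrite /=; ring.
    by apply: sum_node_error_le => // t d; exact: hal.
  apply: Rmult_le_compat_l; first by have := pos_INR n; lra.
  exact: le_bigRmax (inTh s Ss).
(* For fixed [i] the flip is an involution of the assignments where [i] is movable, so the errors at
   [s] and at its flip have the same sum. This 2 and the 5 of the alignment give the constant 10. *)
have pair i : (\big[Rplus/0%R]_(s | movable kn s0 s i) eps
               <= 2 * \big[Rplus/0%R]_(s | movable kn s0 s i) e s i)%R.
  have -> : (2 * \big[Rplus/0%R]_(s | movable kn s0 s i) e s i
     = \big[Rplus/0%R]_(s | movable kn s0 s i) (e s i + e (flip i s) i))%R.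
    have flipE : \big[Rplus/0%R]_(s | movable kn s0 s i) e (flip i s) i
        = \big[Rplus/0%R]_(s | movable kn s0 s i) e s i.
      rewrite [RHS](reindex_inj (inv_inj (@flipK n K i))) /=.
      by apply: eq_bigl => s; rewrite movable_flip.
    by rewrite -Rplus_diag -{2}flipE -big_split.
  apply: Rsum_le => s mov; apply: Rle_trans (test s i mov) _.
  apply: testing_error => //; rewrite flip_same eq_sym.
  by case/and4P: mov.
(* Double counting of the pairs of an assignment and a movable node: each assignment of the support
   has at least [M] such nodes. *)
have low : (nS * (INR M * eps) <= 2 * \big[Rplus/0%R]_(s | S s) \big[Rplus/0%R]_i e s i)%R.
  apply: (Rle_trans _ (\big[Rplus/0%R]_i \big[Rplus/0%R]_(s | movable kn s0 s i) eps)%R).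
    rewrite (exchange_big_dep S) /=; last by move=> i s _ /and4P[].
    rewrite -Rsum_const; apply: Rsum_le => s Ss; rewrite Rsum_const.
    apply: Rmult_le_compat_r => //; apply/le_INR/leP.
    exact: card_movable anc bal Ss.
  rewrite exchange_big big_distrr /=; apply: Rsum_le => i _; apply: Rle_trans (pair i) _.
  apply: Rmult_le_compat_l; first lra.
  rewrite [X in (_ <= X)%R](bigID (fun s => movable kn s0 s i)) /=.
  rewrite [X in (X <= _)%R](eq_bigl (fun s => S s && movable kn s0 s i)); last first.
    by move=> s; rewrite /S /movable; case: near_base; rewrite ?andbF.
  rewrite -[X in (X <= _)%R]Rplus_0_r; apply: Rplus_le_compat_l.
  by apply: Rsum_ge0.
apply: (Rmult_le_reg_l nS) => //; lra.
Qed.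

(** * Explicit bounds for a fixed number of nodes *)

Lemma RlebP (x y : R) : reflect (x <= y)%R (Rleb x y).
Proof. by rewrite /Rleb; case: Rle_dec => h; constructor. Qed.

(** The bound on [eta] leaves a slack of two nodes around [n / K]: one for rounding in [s0] and one
    for the node moved by the prior. *)
Lemma near_base_Theta0 (n K m : nat) (eta : R) (kn : pred 'I_n) (s0 s : assignment n K) :
  (0 < n)%N -> (0 < K)%N -> m = (n %/ K)%N -> balanced s0 m ->
  (2 * INR K / INR n <= eta)%R -> near_base kn s0 s -> in_Theta0 eta s.
Proof.
move=> n0 K0 mE bal heta Ss; apply/forallP => k.
have nR : (0 < INR n)%R by apply/lt_0_INR/ltP.
have KR : (0 < INR K)%R by apply/lt_0_INR/ltP.
have nK0 : (0 < INR n / INR K)%R by apply: Rmult_lt_0_compat => //; exact: Rinv_0_lt_compat.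
have two : (2 <= eta * (INR n / INR K))%R.
  have -> : (2 = 2 * INR K / INR n * (INR n / INR K))%R by field; lra.
  by apply: Rmult_le_compat_r; lra.
have nKE : (INR n / INR K * INR K = INR n)%R by field; lra.
have lo : (INR m <= INR n / INR K)%R.
  apply: (Rmult_le_reg_r (INR K)) => //; rewrite nKE -mult_INR mE.
  exact/le_INR/leP/leq_divM.
have hi : (INR n / INR K <= INR m + 1)%R.
  apply: (Rmult_le_reg_r (INR K)) => //; rewrite nKE -S_INR -mult_INR mE.
  exact/le_INR/leP/ltnW/ltn_ceil.
have [s1 s2] := near_base_size k Ss; have /andP[b1 b2] := bal k.
have /leP/le_INR : (m <= (comm_size s k).+1)%N by lia.
have /leP/le_INR : (comm_size s k <= m.+2)%N by lia.
rewrite !S_INR => u1 u2.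
by apply/andP; split; apply/RlebP; lra.
Qed.

Lemma flip_testing_error (n K m : nat) (a b e x : R) (kn : pred 'I_n)
    (s0 s : assignment n K) (i : 'I_n) :
  (0 < e)%R -> (0 < a / INR n < 1 - e)%R -> (0 < b / INR n < 1 - e)%R ->
  balanced s0 m -> (9 <= m)%N -> movable kn s0 s i -> (INR m * SBM_I n a b <= x)%R ->
  (e * exp (- x - (8 * sqrt (x / e) + 1) / 2)
   <= \big[Rplus/0%R]_(A | is_adj A) Rmin (probA a b s A) (probA a b (flip i s) A))%R.
Proof.
move=> e0 pe qe bal m9 /and4P[_ psi Ss _] mx.
have p01 : (0 < a / INR n < 1)%R by lra.
have q01 : (0 < b / INR n < 1)%R by lra.
set p := (a / INR n)%R in pe p01; set q := (b / INR n)%R in qe q01.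
have IE : SBM_I n a b = (- 2 * ln (affinity p q))%R by [].
have r0 := affinity_gt0 p01 q01; have r1 := affinity_le1 p01 q01.
have re := affinity_ge e0 pe qe.
have lnr : (ln (affinity p q) <= 0)%R.
  by rewrite -ln_1; case: r1 => [/(ln_increasing _ _ r0)|->]; lra.
have mR : (9 <= INR m)%R.
  by have /leP/le_INR := m9; rewrite /=; lra.
have x0 : (0 <= x)%R.
  apply: Rle_trans mx; apply: Rmult_le_pos; lra.
set D1 := split_edges s (flip i s); set D2 := split_edges (flip i s) s.
have D1E : D1.+1 = comm_size s (s i) by exact: split_edges_flip.
have D2E : D2 = comm_size s (partner (s i)) by exact: split_edges_unflip.
have sumE := near_base_pair_sum Ss psi.
have [k1 k2] := near_base_size (s i) Ss; have [l1 l2] := near_base_size (partner (s i)) Ss.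
have /andP[bk1 bk2] := bal (s i); have /andP[bl1 bl2] := bal (partner (s i)).
(* The prior preserves the total size of a matched pair, at most [2 * m + 2], and [i] itself is not
   counted in [D1]. *)
have D12 : (D1 + D2 <= (2 * m).+1)%N by lia.
have Da : (D1 <= D2 + 4)%N by lia.
have Db : (D2 <= D1 + 4)%N by lia.
have D12R : (INR D1 + INR D2 <= 2 * INR m + 1)%R.
  by have /leP/le_INR := D12; rewrite plus_INR S_INR mult_INR /=; lra.
have DaR : (INR D1 - INR D2 <= 4)%R.
  by have /leP/le_INR := Da; rewrite plus_INR /=; lra.
have DbR : (-4 <= INR D1 - INR D2)%R.
  by have /leP/le_INR := Db; rewrite plus_INR /=; lra.
have vle := llr_sqmean_le e0 pe qe.
have mule := llr_mean_sqr_le p01 q01.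
have t0 : (0 < 8 * sqrt (x / e) + 1)%R by have := sqrt_pos (x / e); lra.
have xe0 : (0 <= x / e)%R by apply: Rmult_le_pos => //; exact/Rlt_le/Rinv_0_lt_compat.
apply: Rle_trans (@sbm_testing n K a b (8 * sqrt (x / e) + 1) s (flip i s) p01 q01 t0 _).
  have -> : (- x - (8 * sqrt (x / e) + 1) / 2 = - x + - (8 * sqrt (x / e) + 1) / 2)%R by field.
  rewrite exp_plus -Rmult_assoc; apply: Rmult_le_compat_r; first exact/Rlt_le/exp_pos.
  rewrite -/p -/q -/D1 -/D2.
  (* [2 * m] factors give at least [exp (- x)]; the remaining one is at least [e]. *)
  apply: (Rle_trans _ (affinity p q ^ (2 * m).+1)%R).
    rewrite /pow -/pow; apply: Rmult_le_compat; try lra; first exact/Rlt_le/exp_pos.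
    rewrite -exp_ln_affinity //.
    have : (- x <= INR (2 * m) * ln (affinity p q))%R.
      by move: mx; rewrite IE mult_INR /=; lra.
    by case=> [/exp_increasing|->]; lra.
  have -> : ((2 * m).+1 = (D1 + D2) + ((2 * m).+1 - (D1 + D2)))%N by lia.
  rewrite pow_add -[X in (_ <= X)%R]Rmult_1_r; apply: Rmult_le_compat_l.
    by apply: pow_le; lra.
  rewrite -(pow1 ((2 * m).+1 - (D1 + D2))); apply: pow_incr; lra.
rewrite -/p -/q -/D1 -/D2.
set v := llr_sqmean p q in vle mule *; set mu := llr_mean p q in mule *.
have v0 : (0 <= v)%R by apply: Rle_trans mule; exact: pow2_ge_0.
have -> : (((INR D1 - INR D2) * mu) ^ 2 = (INR D1 - INR D2) ^ 2 * mu ^ 2)%R by ring.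
have d16 : ((INR D1 - INR D2) ^ 2 <= 16)%R.
  have : (0 <= (4 - (INR D1 - INR D2)) * (4 + (INR D1 - INR D2)))%R.
    by apply: Rmult_le_pos; lra.
  by lra.
have h1 : ((INR D1 + INR D2) * v <= (2 * INR m + 1) * v)%R by apply: Rmult_le_compat_r.
have h2 : ((INR D1 - INR D2) ^ 2 * mu ^ 2 <= 16 * v)%R.
  by apply: Rmult_le_compat => //; exact: pow2_ge_0.
(* The 17 is 1 from [D12] and 16 from the squared difference of the counts; [9 <= m] absorbs it. The
   resulting [64 * (x / e)] is the square of [8 * sqrt (x / e)], and the added 1 keeps the parameter
   positive when [x = 0]. *)
have h3 : ((2 * INR m + 17) * v <= 4 * INR m * v)%R by apply: Rmult_le_compat_r; lra.
have h4 : (4 * INR m * v <= 4 * INR m * (16 / e * SBM_I n a b))%R.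
  by apply: Rmult_le_compat_l; [lra | rewrite IE].
have h5 : (4 * INR m * (16 / e * SBM_I n a b) <= 64 * (x / e))%R.
  have -> : (4 * INR m * (16 / e * SBM_I n a b) = 64 * (INR m * SBM_I n a b / e))%R.
    by field; lra.
  apply: Rmult_le_compat_l; first lra.
  by apply: Rmult_le_compat_r => //; exact/Rlt_le/Rinv_0_lt_compat.
have := sqrt_sqrt _ xe0; have := sqrt_pos (x / e).
by rewrite /=; lra.
Qed.

Lemma sbm_lower_bound (n K : nat) (a b eta e : R) (q : estimator n K) :
  (0 < e)%R -> (2 <= K)%N -> (0 < b)%R -> (b < a)%R -> (a / INR n < 1 - e)%R ->
  (2 * INR K / INR n <= eta)%R -> (20 * K <= n)%N -> is_estimator q ->
  let x := (INR n * SBM_I n a b / INR K)%R in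
  (0 <= x)%R /\
  (e / 120 * exp (- x - (8 * sqrt (x / e) + 1) / 2) <= worst_risk a b eta q)%R.
Proof.
move=> e0 K2 b0 ba ane heta nK qest x.
have K0 : (0 < K)%N by lia.
have n0 : (0 < n)%N by lia.
have nR : (0 < INR n)%R by apply/lt_0_INR/ltP.
have KR : (0 < INR K)%R by apply/lt_0_INR/ltP.
have pe : (0 < a / INR n < 1 - e)%R.
  by split=> //; apply: Rmult_lt_0_compat; [lra | exact: Rinv_0_lt_compat].
have qe : (0 < b / INR n < 1 - e)%R.
  split; first by apply: Rmult_lt_0_compat => //; exact: Rinv_0_lt_compat.
  apply: Rlt_trans ane; apply: Rmult_lt_compat_r => //; exact: Rinv_0_lt_compat.
have p01 : (0 < a / INR n < 1)%R by lra.
have q01 : (0 < b / INR n < 1)%R by lra.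
have I0 : (0 <= SBM_I n a b)%R.
  have r0 := affinity_gt0 p01 q01; have r1 := affinity_le1 p01 q01.
  rewrite /SBM_I -/(affinity (a / INR n) (b / INR n)).
  suff : (ln (affinity (a / INR n) (b / INR n)) <= 0)%R by lra.
  by rewrite -ln_1; case: r1 => [/(ln_increasing _ _ r0)|->]; lra.
set m := (n %/ K)%N.
have m20 : (20 <= m)%N by rewrite leq_divRL.
have mx : (INR m * SBM_I n a b <= x)%R.
  have -> : (x = INR n / INR K * SBM_I n a b)%R by rewrite /x; field; lra.
  apply: Rmult_le_compat_r => //; apply: (Rmult_le_reg_r (INR K)) => //.
  have -> : (INR n / INR K * INR K = INR n)%R by field; lra.
  by rewrite -mult_INR; apply/le_INR/leP; exact: leq_divM.
have x0 : (0 <= x)%R by apply: Rle_trans mx; apply: Rmult_le_pos => //; exact: pos_INR.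
split=> //.
have hK : (m./2 * K <= n)%N.
  by apply: leq_trans (leq_divM n K); rewrite leq_mul2r; apply/orP; right; rewrite -/m; lia.
have bal : balanced (base_assignment n K0) m := @base_balanced n K K0.
set E := exp _.
have E0 : (0 < E)%R by exact: exp_pos.
have m3 : (m.+2 <= 3 * m./2)%N by lia.
have m9 : (9 <= m)%N by lia.
have eE0 : (0 <= e * E)%R by apply: Rmult_le_pos; lra.
have := @worst_risk_ge n K m m./2 a b eta (e * E) q _ _ n0 p01 q01 qest
  (base_anchored K0 hK) bal m3 eE0
  (fun s => near_base_Theta0 n0 K0 erefl bal heta)
  (fun s i mov => flip_testing_error e0 pe qe bal m9 mov mx).
(* A positive fraction of the nodes is movable; the factor 3 covers [K = 3], where one community is
   unmatched. With the 10 of [worst_risk_ge] this gives 120. *)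
have nM : (n <= 12 * (K./2 * (m - m./2)))%N.
  have nlt : (n < m.+1 * K)%N by exact: ltn_ceil.
  have h1 : (K <= 3 * K./2)%N by lia.
  have h2 : (m.+1 <= 4 * (m - m./2))%N by lia.
  by have := leq_mul h2 h1; lia.
have /leP/le_INR := nM; rewrite [INR (12 * _)]mult_INR.
have -> : INR 12 = 12%R by rewrite /=; ring.
move=> /(Rmult_le_compat_l _ _ _ eE0) h12 hw.
apply: (Rmult_le_reg_l (120 * INR n)); first lra.
have -> : (120 * INR n * (e / 120 * E) = e * E * INR n)%R by field.
by lra.
Qed.

(** * Passage to the limit *)

Lemma sqrt_overhead_cv (x : nat -> R) (e C : R) : (0 < e)%R -> cv_infty x ->
  Un_cv (fun n => (4 * sqrt (x n / e) + C) / x n)%R 0%R.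
Proof.
move=> e0 xinf eps eps0.
have se0 : (0 < sqrt e)%R by exact: sqrt_lt_R0.
set B := (4 / sqrt e + Rabs C)%R.
have B0 : (0 <= B)%R.
  have : (0 < 4 / sqrt e)%R by apply: Rmult_lt_0_compat; [lra | exact: Rinv_0_lt_compat].
  by have := Rabs_pos C; rewrite /B; lra.
have Be0 : (0 <= B / eps)%R by apply: Rmult_le_pos => //; exact/Rlt_le/Rinv_0_lt_compat.
(* Beyond this threshold [y = sqrt (x n)] exceeds 1, so the numerator over [y] is at most [B], and
   [eps * y] exceeds [B]. *)
have [N HN] := xinf ((1 + B / eps) ^ 2)%R; exists N => n nN; have xn := HN n nN.
have x0 : (0 < x n)%R by apply: Rle_lt_trans xn; exact: pow2_ge_0.
set y := sqrt (x n).
have yy : (y * y = x n)%R by apply: sqrt_sqrt; lra.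
have y0 : (0 < y)%R by exact: sqrt_lt_R0.
have yB : (1 + B / eps < y)%R.
  rewrite -(sqrt_square (1 + B / eps)); last lra.
  by apply: sqrt_lt_1_alt; split; [exact: Rle_0_sqr | move: xn; rewrite /=; lra].
have absV z : Rabs (z / y) = (Rabs z / y)%R.
  by rewrite /Rdiv Rabs_mult Rabs_inv (Rabs_pos_eq y) //; lra.
have sE : (sqrt (x n / e) = y / sqrt e)%R by rewrite sqrt_div_alt.
rewrite /Rdist Rminus_0_r sE -yy.
have -> : ((4 * (y / sqrt e) + C) / (y * y) = (4 / sqrt e + C / y) / y)%R by field; lra.
rewrite absV.
have CyC : (Rabs (C / y) <= Rabs C)%R.
  rewrite absV.
  apply: (Rmult_le_reg_r y) => //.
  have -> : (Rabs C / y * y = Rabs C)%R by field; lra.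
  rewrite -{1}[Rabs C]Rmult_1_r; apply: Rmult_le_compat_l; [exact: Rabs_pos | lra].
have num : (Rabs (4 / sqrt e + C / y) <= B)%R.
  apply: Rle_trans (Rabs_triang _ _) _; rewrite Rabs_pos_eq; first by rewrite /B; lra.
  by apply: Rmult_le_pos; [lra | exact/Rlt_le/Rinv_0_lt_compat].
apply: (Rmult_lt_reg_r y) => //.
have -> : (Rabs (4 / sqrt e + C / y) / y * y = Rabs (4 / sqrt e + C / y))%R by field; lra.
apply: Rle_lt_trans num _.
have := Rmult_lt_compat_l eps _ _ eps0 yB.
have -> : (eps * (1 + B / eps) = eps + B)%R by field; lra.
by lra.
Qed.

Theorem theorem3 (eps0 : R) (K : nat -> nat) (a b eta : nat -> R) :
  (0 < eps0)%R ->
  (forall n : nat, (0 < n)%N ->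
     (2 <= K n)%N /\ (eps0 < b n)%R /\ (b n < a n)%R /\
     (a n / INR n < 1 - eps0)%R /\
     (2 * INR (K n) / INR n <= eta n)%R) ->
  Un_cv eta 0%R ->
  (cv_infty (fun n => INR n * SBM_I n (a n) (b n) / INR (K n))%R ->
     exists delta : nat -> R, Un_cv delta 0%R /\
       exists N : nat, forall n : nat, (N <= n)%N ->
         forall q : estimator n (K n), is_estimator q ->
           (exp (- (1 + delta n) * (INR n * SBM_I n (a n) (b n) / INR (K n)))
              <= worst_risk (a n) (b n) (eta n) q)%R)
  /\
  ((exists C : R, exists N : nat, forall n : nat, (N <= n)%N ->
       (Rabs (INR n * SBM_I n (a n) (b n) / INR (K n)) <= C)%R) ->
     exists c : R, (0 < c)%R /\
       exists N : nat, forall n : nat, (N <= n)%N ->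
         forall q : estimator n (K n), is_estimator q ->
           (c <= worst_risk (a n) (b n) (eta n) q)%R).
Proof.
move=> e0 hyp etacv; set x := fun n => (INR n * SBM_I n (a n) (b n) / INR (K n))%R.
have [N HN] : exists N, forall n, (N <= n)%N -> forall q : estimator n (K n), is_estimator q ->
    (0 <= x n)%R /\
    (eps0 / 120 * exp (- x n - (8 * sqrt (x n / eps0) + 1) / 2)
     <= worst_risk (a n) (b n) (eta n) q)%R.
  (* Once [eta n < 1 / 10], the bound [2 K / n <= eta n] forces [20 K <= n]. *)
  have tenth : (1 / 10 > 0)%R by lra.
  have [N HN] := etacv _ tenth; exists N.+1 => n nN q qest.
  have n0 : (0 < n)%N by lia.
  have [K2 [eb [ba [an Keta]]]] := hyp n n0.
  have b0 : (0 < b n)%R by lra.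
  apply: sbm_lower_bound => //.
  have nR : (0 < INR n)%R by apply/lt_0_INR/ltP.
  have etan : (eta n < 1 / 10)%R.
    by have := HN n ltac:(lia); rewrite /Rdist Rminus_0_r; split_Rabs; lra.
  apply/leP/INR_le; rewrite mult_INR.
  have -> : INR 20 = 20%R by rewrite /=; ring.
  have : (2 * INR (K n) / INR n * INR n <= 1 / 10 * INR n)%R.
    by apply: Rmult_le_compat_r; lra.
  have -> : (2 * INR (K n) / INR n * INR n = 2 * INR (K n))%R by field; lra.
  by lra.
split.
  (* [C] collects the constant part of the exponent and the prefactor [eps0 / 120]; dividing the
     whole overhead by [x n] gives [delta]. *)
  move=> xinf; pose C := (1 / 2 + ln (120 / eps0))%R.
  exists (fun n => (4 * sqrt (x n / eps0) + C) / x n)%R.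
  split; first exact: sqrt_overhead_cv.
  have [N' HN'] := xinf 0%R; exists (maxn N N') => n nN q qest.
  have x0 : (0 < x n)%R by apply: HN'; lia.
  have [_ ] := HN n ltac:(lia) q qest; apply: Rle_trans; apply: Req_le.
  rewrite -/(x n).
  have -> : (- (1 + (4 * sqrt (x n / eps0) + C) / x n) * x n
     = - ln (120 / eps0) + (- x n - (8 * sqrt (x n / eps0) + 1) / 2))%R.
    by rewrite /C; field; lra.
  have pos : (0 < 120 / eps0)%R.
    by apply: Rmult_lt_0_compat; [lra | exact: Rinv_0_lt_compat].
  by rewrite exp_plus exp_Ropp exp_ln // Rinv_div.
move=> [C [N' HN']].
(* The explicit bound decreases in [x n], so its value at the upper bound [C] works for all large
   [n]. *)
exists (eps0 / 120 * exp (- C - (8 * sqrt (C / eps0) + 1) / 2))%R; split.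
  by apply: Rmult_lt_0_compat; [lra | exact: exp_pos].
exists (maxn N N') => n nN q qest.
have [x0] := HN n ltac:(lia) q qest; apply: Rle_trans.
have xC : (x n <= C)%R by apply: Rle_trans (Rle_abs _) (HN' n _); lia.
apply: Rmult_le_compat_l; first lra.
have sq : (sqrt (x n / eps0) <= sqrt (C / eps0))%R.
  by apply: sqrt_le_1_alt; apply: Rmult_le_compat_r => //; exact/Rlt_le/Rinv_0_lt_compat.
have : (- C - (8 * sqrt (C / eps0) + 1) / 2 <= - x n - (8 * sqrt (x n / eps0) + 1) / 2)%R.
  by lra.
by case=> [/exp_increasing|->]; lra.
Qed.
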